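(* Let $\alpha,\beta>0$ and let $\delta\in(0,1)$, $t_n=n^{\delta/2}$. For each $n\ge 1$ let $\theta=(\theta_1,\dots,\theta_n)$ be the random vector in $\mathbb{R}^n$ with $\theta_j\mid\tau\sim \mathrm{N}(0,\tau)$ independently for $j=1,\dots,n$ (a global-local prior with all local scales $\psi_j=1$), where the global variance parameter $\tau$ has an inverse-gamma $\mathrm{IG}(\alpha,\beta)$ distribution. Then there is a constant $C>0$ depending only on $\alpha$ and $\beta$ such that, for every $n$, $$\mathbb{P}(\|\theta\|_2<t_n)\le e^{-C n^{1-\delta}}.$$
   Context: $\|\cdot\|_2$ is the Euclidean norm. $\mathrm{N}(0,\tau)$ denotes the normal distribution with variance $\tau$. The $\mathrm{IG}(\alpha,\beta)$ distribution has density $\frac{\beta^\alpha}{\Gamma(\alpha)}\tau^{-(1+\alpha)}e^{-\beta/\tau}$ on $(0,\infty)$. The hyperparameters $\alpha,\beta$ do not depend on $n$. *)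

(* Defs.v *)
From mathcomp Require Export all_boot all_order all_algebra.
From mathcomp Require Export all_classical all_reals all_analysis.

Set Implicit Arguments.
Unset Strict Implicit.
Unset Printing Implicit Defensive.

Export Order.TTheory GRing.Theory Num.Theory.
Export numFieldNormedType.Exports.

Local Open Scope classical_set_scope.
Local Open Scope ring_scope.

Definition gamma_fun {R : realType} (a : R) : R :=
  \int[lebesgue_measure]_(x in `]0, +oo[) (x `^ (a - 1) * expR (- x)).

Definition inv_gamma_pdf {R : realType} (a b t : R) : R :=
  if 0 < t then b `^ a / gamma_fun a * t `^ (- (1 + a)) * expR (- (b / t))
  else 0.

Definition inv_gamma_prob {R : realType} (a b : R) : set R -> \bar R :=
  fun A => (\int[lebesgue_measure]_(t in A) (inv_gamma_pdf a b t)%:E)%E.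

(* [normal_prob] is parameterized by the standard deviation, hence the square
   root. The library gives [normal_prob 0 0] a junk value, so this is N(0, v)
   only for 0 < v. *)
Definition normal_var {R : realType} (v : R) : set R -> \bar R :=
  normal_prob 0 (Num.sqrt v).

(* Given [X], the coordinates of [Y] are independent and each has conditional
   law [K X]: a regular conditional distribution of [Y] given [X] is the
   product of [n] copies of [K], tested on measurable rectangles. *)
Definition cond_iid {R : realType} (d : measure_display)
    (Omega : measurableType d) (P : probability Omega R) (n : nat)
    (X : {RV P >-> R}) (Y : 'I_n -> {RV P >-> R})
    (K : R -> set R -> \bar R) : Prop :=
  forall (A : set R) (B : 'I_n -> set R),
    measurable A -> (forall j, measurable (B j)) ->
    P [set w | A (X w) /\ forall j, B j (Y j w)] =
    (\int[distribution P X]_(x in A) \prod_(j < n) K x (B j))%E.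

Definition l2norm {R : realType} (n : nat) (x : 'I_n -> R) : R :=
  Num.sqrt (\sum_(j < n) x j ^+ 2).

(* Main.v *)
Require Import Defs.
From mathcomp Require Import zify ring lra measurable_realfun.

(* Put m = n^(1 - delta), so that the event is ||theta||^2 < n / m. On it, at least
   half of the coordinates satisfy theta_j^2 <= 2 / m. If tau > s = 512 / m, one
   coordinate does so with conditional probability at most 1/16, and a union bound
   over the sets of at least n / 2 coordinates costs 2^n, whence
     P(||theta||^2 < n / m) <= P(tau <= s) + 2^(-n) P(tau > s);
   only rectangles are involved, so the joint law of theta is never needed.
   Since P(tau <= s) <= A exp(- beta / (2 s)), the right-hand side is exponentially
   small in m up to a constant factor. As s <= 512, P(tau > s) is bounded below, so
   the right-hand side is also bounded away from 1 for all n >= 1, and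
   interpolating between these two bounds removes the constant factor. *)

Local Open Scope classical_set_scope.
Local Open Scope ring_scope.

(** * Comparison of integrals, and a finite union bound *)

(** The integral of a nonnegative function is a supremum over the simple functions below it, so no
    measurability enters. This matters for integrands built from [K] in [cond_iid], about whose
    measurability nothing is assumed. *)
Lemma ge0_le_integral_restrict d (T : measurableType d) (R : realType)
    (mu : {measure set T -> \bar R}) (D E : set T) (f g : T -> \bar R) :
  (forall x, D x -> 0 <= f x)%E -> (forall x, E x -> 0 <= g x)%E ->
  (forall x, (f \_ D) x <= (g \_ E) x)%E ->
  (\int[mu]_(x in D) f x <= \int[mu]_(x in E) g x)%E.
Proof.
move=> f0 g0 fg; rewrite !ge0_integralE //; apply: ereal_sup_le.
by move=> _ [h hf <-]; exists h => // x; exact: le_trans (hf x) (fg x).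
Qed.

Lemma integral_le_cst d (T : measurableType d) (R : realType)
    (mu : {measure set T -> \bar R}) (D E : set T) (f : T -> \bar R) (c : \bar R) :
  measurable E -> (0 <= c)%E -> (forall x, D x -> 0 <= f x)%E ->
  (forall x, D x -> E x -> f x <= c)%E -> (forall x, D x -> ~ E x -> f x = 0)%E ->
  (\int[mu]_(x in D) f x <= c * mu E)%E.
Proof.
move=> mE c0 f0 fc f00; rewrite -integral_cst//.
apply: ge0_le_integral_restrict => // x; rewrite !patchE.
have [/set_mem Dx|_] := boolP (x \in D); have [/set_mem Ex|/negP] := boolP (x \in E) => //.
- exact: fc.
- by move=> nE; rewrite f00// => Ex; apply: nE; exact: mem_set.
Qed.

Lemma cst_le_integral d (T : measurableType d) (R : realType)
    (mu : {measure set T -> \bar R}) (D E : set T) (f : T -> \bar R) (c : \bar R) :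
  measurable E -> E `<=` D -> (0 <= c)%E -> (forall x, D x -> 0 <= f x)%E ->
  (forall x, E x -> c <= f x)%E -> (c * mu E <= \int[mu]_(x in D) f x)%E.
Proof.
move=> mE ED c0 f0 fc; rewrite -integral_cst//.
apply: ge0_le_integral_restrict => // x; rewrite !patchE.
have [/set_mem Ex|_] := boolP (x \in E).
  by rewrite mem_set; [exact: fc|exact: ED].
by have [/set_mem /f0|] := boolP (x \in D).
Qed.

Lemma measure_bigsetU_le d (T : measurableType d) (R : realType)
    (mu : {measure set T -> \bar R}) (I : Type) (s : seq I) (Q : pred I)
    (F : I -> set T) : (forall i, measurable (F i)) ->
  (mu (\big[setU/set0]_(i <- s | Q i) F i) <= \sum_(i <- s | Q i) mu (F i))%E.
Proof.
move=> mF; elim: s => [|i s IH]; first by rewrite !big_nil measure0.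
rewrite !big_cons; case: ifP => // _.
apply: le_trans (measureU2 _ _ _) _ => //; last exact: leeD.
exact: bigsetU_measurable.
Qed.

(** * Small balls for conditionally Gaussian coordinates *)

(** The density is at most its peak [1 / sqrt (2 pi v)], the interval has length [2 a], and
    [2 <= sqrt (2 pi)] because [pi >= 2]. *)
Lemma normal_var_itv (R : realType) (v a : R) : 0 < v -> 0 <= a ->
  (normal_var v `[(- a)%R, a] <= (a / Num.sqrt v)%:E)%E.
Proof.
move=> v0 a0; have sv0 : 0 < Num.sqrt v by rewrite sqrtr_gt0.
rewrite /normal_var /normal_prob.
apply: le_trans (@integral_le_cst _ _ R lebesgue_measure _
  `[(- a), a] _ (normal_peak (Num.sqrt v))%:E _ _ _ _ _) _ => //.
- by rewrite lee_fin normal_peak_ge0.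
- by move=> x _; rewrite lee_fin normal_pdf_ge0.
- by move=> x _ _; rewrite lee_fin normal_pdf_ub ?gt_eqF.
rewrite /= lebesgue_measure_itv/= lte_fin; case: ifPn => _; last first.
  by rewrite mule0 lee_fin divr_ge0// ltW.
rewrite -EFinD -EFinM lee_fin opprK.
have -> : normal_peak (Num.sqrt v) * (a + a) = a * (normal_peak (Num.sqrt v) * 2) by ring.
apply: ler_wpM2l => //; rewrite /normal_peak sqr_sqrtr; last exact: ltW.
have S0 : 0 < v * pi *+ 2 by rewrite pmulrn_lgt0// mulr_gt0// pi_gt0.
rewrite ler_pdivrMl ?sqrtr_gt0// ler_pdivlMr// [2 * _]mulrC.
have -> : Num.sqrt v * 2 = Num.sqrt (v * 4).
  rewrite sqrtrM; last exact: ltW.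
  congr (_ * _).
  by rewrite (_ : 4 = 2 ^+ 2) ?sqrtr_sqr ?ger0_norm; last ring.
rewrite ler_sqrt; last exact: ltW.
have := pi_ge2 R; rewrite -mulr_natr; nra.
Qed.

(** Each term is at most [x ^+ n], as [2 |S| >= n] and [x <= 1], and there are [2 ^ n] subsets: this
    is the cost of the union bound. *)
Lemma sum_subsets_le (R : realType) (n : nat) (x : R) : 0 <= x <= 1 ->
  \sum_(S : {set 'I_n} | (n <= 2 * #|S|)%N) (x ^+ 2) ^+ #|S| <= (2 * x) ^+ n.
Proof.
move=> /andP[x0 x1]; apply: (@le_trans _ _ (\sum_(S : {set 'I_n}) x ^+ n)).
  rewrite big_mkcond/=; apply: ler_sum => S _; case: ifPn => nS; last exact: exprn_ge0.
  by rewrite -exprM; apply: ler_wiXn2l.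
rewrite sumr_const -cardsT -powersetT card_powerset cardsT card_ord.
by rewrite exprMn -natrX mulr_natl.
Qed.

(** Otherwise more than half of the coordinates exceed [a] in absolute value, and their squares
    alone add up to at least [n a^2 / 2 >= r^2]. *)
Lemma small_coords (R : realType) (n : nat) (x : 'I_n -> R) (a r : R) :
  0 <= r -> 0 <= a -> 2 * r ^+ 2 <= n%:R * a ^+ 2 -> l2norm x < r ->
  (n <= 2 * #|[set j | (`|x j| <= a)%R]%SET|)%N.
Proof.
move=> r0 a0 ra xr; rewrite leqNgt; apply/negP => nS.
set S := [set j | _]%SET in nS.
have sx0 : 0 <= \sum_(j < n) x j ^+ 2 by apply: sumr_ge0 => j _; exact: sqr_ge0.
have : \sum_(j < n) x j ^+ 2 < r ^+ 2.
  by rewrite -(sqr_sqrtr sx0) ltr_pXn2r// ?nnegrE ?sqrtr_ge0.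
apply/negP; rewrite -leNgt.
apply: (@le_trans _ _ (\sum_(j in ~: S) a ^+ 2)); last first.
  rewrite [leRHS](bigID (mem (~: S)))/= ler_wpDr//.
    by apply: sumr_ge0 => j _; exact: sqr_ge0.
  apply: ler_sum => j; rewrite !inE -ltNge => aj.
  by rewrite -[leRHS]real_normK ?num_real// ler_pXn2r ?nnegrE// ltW.
rewrite sumr_const -mulr_natl.
have := cardsC S; rewrite card_ord => nE.
have : (n%:R : R) <= 2 * #|~: S|%:R by rewrite -natrM ler_nat; lia.
have := sqr_ge0 a; set y := (_%:R); nra.
Qed.

(** Constraining only the coordinates in [S] gives a rectangle whose other sides are [setT], of mass
    1, so that [|S|] factors remain, each at most [c]. *)
Lemma cond_iid_le (R : realType) (d : measure_display)
    (Omega : measurableType d) (P : probability Omega R) (n : nat)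
    (X : {RV P >-> R}) (Y : 'I_n -> {RV P >-> R}) (K : R -> set R -> \bar R)
    (A B : set R) (c : R) (S : {set 'I_n}) :
  cond_iid X Y K -> measurable A -> measurable B -> 0 <= c ->
  (forall x, A x -> 0 <= K x B <= c%:E)%E -> (forall x, A x -> K x setT = 1%E) ->
  (P [set w | A (X w) /\ forall j, j \in S -> B (Y j w)] <=
     (c ^+ #|S|)%:E * distribution P X A)%E.
Proof.
move=> iid mA mB c0 KB KT.
pose BS (j : 'I_n) := if j \in S then B else setT.
have mBS j : measurable (BS j) by rewrite /BS; case: ifP.
have -> : [set w | A (X w) /\ forall j, j \in S -> B (Y j w)] =
    [set w | A (X w) /\ forall j, BS j (Y j w)].
  apply/seteqP; split => w /= [Aw Bw]; split => // j.
    by rewrite /BS; case: ifPn => // /Bw.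
  by move=> jS; have := Bw j; rewrite /BS jS.
have KE x : A x -> (\prod_(j < n) K x (BS j) = \prod_(j in S) K x B)%E.
  move=> Ax; rewrite [RHS]big_mkcond; apply: eq_bigr => j _.
  by rewrite /BS; case: ifP => // _; exact: KT.
have K0 x : A x -> (0 <= \prod_(j < n) K x (BS j))%E.
  by move=> Ax; rewrite KE//; apply: prode_ge0 => j _; case/andP: (KB x Ax).
rewrite iid//; apply: integral_le_cst => //.
  by rewrite lee_fin exprn_ge0.
move=> x Ax _; rewrite KE//; have /andP[k0 kc] := KB x Ax.
rewrite big_const; elim: #|S| => [|k IH] //=.
rewrite exprS EFinM; apply: lee_pmul => //.
by elim: k {IH} => //= k; exact: mule_ge0.
Qed.

Lemma l2norm_small_ball (R : realType) (d : measure_display)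
    (Omega : measurableType d) (P : probability Omega R) (n : nat)
    (tau : {RV P >-> R}) (theta : 'I_n -> {RV P >-> R}) (A : set R) (a r : R) :
  cond_iid tau theta normal_var ->
  measurable A -> (forall t, A t -> 256 * a ^+ 2 <= t) ->
  0 <= r -> 0 < a -> 2 * r ^+ 2 <= n%:R * a ^+ 2 ->
  (P [set w | (l2norm (fun j => theta j w) < r)%R] <=
    distribution P tau (~` A) + (2^-1 ^+ n)%:E * distribution P tau A)%E.
Proof.
move=> iid mA Ale r0 a0 ra.
have ml2 : measurable_fun setT (fun w => l2norm (fun j => theta j w)).
  apply: measurableT_comp.
    by apply: continuous_measurable_fun; exact: sqrt_continuous.
  by apply: measurable_sum => j; exact: measurable_funX.
have mE : measurable [set w | (l2norm (fun j => theta j w) < r)%R].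
  rewrite (_ : [set w | _] = (fun w => l2norm (fun j => theta j w)) @^-1` `]-oo, r[).
    by rewrite -[X in measurable X]setTI; apply: ml2.
  by apply/seteqP; split => w /=; rewrite in_itv.
pose B : set R := `[(- a), a]%classic.
pose F (S : {set 'I_n}) := [set w | A (tau w) /\ forall j, j \in S -> B (theta j w)].
have mF S : measurable (F S).
  have -> : F S = tau @^-1` A `&` \bigcap_(j in [set j | j \in S]) (theta j @^-1` B).
    by apply/seteqP; split => w [].
  apply: measurableI; first exact: measurable_funPTI.
  by apply: fin_bigcap_measurable => // j _; apply: measurable_funPTI; exact: measurable_itv.
(* Since [256 = 16^2], the standard deviation is at least [16 a] on [A]. Writing [1/16] as a square
   lets [sum_subsets_le] apply with [x = 1/4], giving [(2/4)^n = 2^(-n)]. *)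
have KB t : A t -> (0 <= normal_var t B <= (1 / 4 ^+ 2)%:E)%E.
  move=> /Ale at_.
  have a2 : 0 < 256 * a ^+ 2 by rewrite mulr_gt0// exprn_gt0.
  apply/andP; split; first by rewrite /normal_var measure_ge0.
  apply: (le_trans (@normal_var_itv R t a _ _)); [exact: lt_le_trans at_|exact: ltW|].
  rewrite lee_fin ler_pdivrMr ?sqrtr_gt0; last exact: lt_le_trans at_.
  have : Num.sqrt (256 * a ^+ 2) <= Num.sqrt t by rewrite ler_sqrt// (le_trans (ltW a2)).
  rewrite (_ : 256 * a ^+ 2 = (16 * a) ^+ 2); last by ring.
  rewrite sqrtr_sqr ger0_norm; last by apply: mulr_ge0 => //; exact: ltW.
  lra.
have KT t : A t -> normal_var t setT = 1%E by move=> _; exact: probability_setT.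
(* Either [tau] misses [A], or all coordinates in some [S] with at least [n / 2] elements lie in
   [B]. *)
apply: (@le_trans _ _ (P (tau @^-1` (~` A) `|`
    \big[setU/set0]_(S : {set 'I_n} | (n <= 2 * #|S|)%N) F S))).
  apply: le_measure; rewrite ?inE//.
    apply: measurableU; last exact: bigsetU_measurable.
    by apply: measurable_funPTI; exact: measurableC.
  move=> w /= wr; have [Aw|] := pselect (A (tau w)); last by left.
  right; have nS := small_coords _ _ _ _ _ r0 (ltW a0) ra wr.
  rewrite (bigD1 [set j | (`|theta j w| <= a)%R]%SET)//=; left; split => // j.
  by rewrite inE /B/= in_itv/= ler_norml.
apply: le_trans (measureU2 _ _ _) _.
- by apply: measurable_funPTI; exact: measurableC.
- exact: bigsetU_measurable.
apply: leeD => //; apply: le_trans (measure_bigsetU_le _ _ _ _ _ _ _ _ mF) _.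
apply: (@le_trans _ _ (\sum_(S : {set 'I_n} | (n <= 2 * #|S|)%N)
    ((4^-1 ^+ 2) ^+ #|S|)%:E * distribution P tau A)%E).
  apply: lee_sum => S _; apply: (@cond_iid_le _ _ _ P _ tau theta normal_var A B) => //.
  - exact: measurable_itv.
  - by move=> t At; have := KB t At; rewrite div1r exprVn.
rewrite -ge0_sume_distrl; last by move=> S _; rewrite lee_fin !exprn_ge0.
apply: lee_wpmul2r; first exact: measure_ge0.
rewrite sumEFin lee_fin; apply: le_trans (sum_subsets_le _ _ _ _) _; first lra.
by rewrite (_ : 2 * 4^-1 = 2^-1)//; field.
Qed.

(** * Tails of the inverse-gamma law *)

Lemma inv_gamma_cst_ge0 (R : realType) (a b : R) : 0 <= b `^ a / gamma_fun a.
Proof.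
apply: divr_ge0; first exact: powR_ge0.
by apply: Rintegral_ge0 => x _; rewrite mulr_ge0 ?powR_ge0 ?expR_ge0.
Qed.

Lemma inv_gamma_pdf_ge0 (R : realType) (a b t : R) : 0 <= inv_gamma_pdf a b t.
Proof.
rewrite /inv_gamma_pdf; case: ifP => // _.
by rewrite !(inv_gamma_cst_ge0, powR_ge0, expR_ge0, mulr_ge0).
Qed.

(* Half of the exponent [- b / t] absorbs the singular factor [t `^ (- (1 + a))]. *)
Lemma inv_gamma_pdf_le (R : realType) (a b s t : R) : 0 < a -> 0 < b -> 0 < t <= s ->
  inv_gamma_pdf a b t <=
    b `^ a / gamma_fun a * (2 * (1 + a) / b) `^ (1 + a) * expR (- (b / (2 * s))).
Proof.
move=> a0 b0 /andP[t0 ts]; rewrite /inv_gamma_pdf t0 -!mulrA ler_wpM2l//.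
  exact: powR_ge0.
rewrite ler_wpM2l//.
  by rewrite invr_ge0; apply: Rintegral_ge0 => x _; rewrite mulr_ge0 ?powR_ge0 ?expR_ge0.
have K0 : 0 < 2 * ((1 + a) / b) by rewrite mulr_gt0// divr_gt0//; lra.
rewrite /powR !gt_eqF// -!expRD ler_expR.
(* With [y = 2 (1 + a) t / b], the inequality [1 - ln y <= 1 / y] times [1 + a] controls the power
   of [t], because [(1 + a) / y = b / (2 t)]. *)
have := expR_ge1Dx (- ln (t * (2 * ((1 + a) / b)))).
rewrite expRN lnK ?posrE ?(mulr_gt0 t0 K0)// lnM ?posrE// => h.
have tb : b / t = 2 * ((1 + a) * (t * (2 * ((1 + a) / b)))^-1).
  by field; rewrite !gt_eqF//; lra.
have bs : b / (2 * s) <= b / t / 2.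
  rewrite -mulrA -invfM; apply: ler_wpM2l; first exact: ltW.
  by rewrite lef_pV2 ?posrE; lra.
move: tb bs h; set u := (t * _)^-1; set v := b / t; set w := b / (2 * s); nra.
Qed.

Lemma inv_gamma_prob_le (R : realType) (a b s : R) : 0 < a -> 0 < b -> 0 < s ->
  (inv_gamma_prob a b (~` `]s, +oo[) <=
   (b `^ a / gamma_fun a * (2 * (1 + a) / b) `^ (1 + a) * expR (- (b / (2 * s))) * s)%:E)%E.
Proof.
move=> a0 b0 s0; rewrite /inv_gamma_prob.
apply: le_trans (@integral_le_cst _ _ R lebesgue_measure _ `]0, s] _
  (b `^ a / gamma_fun a * (2 * (1 + a) / b) `^ (1 + a) * expR (- (b / (2 * s))))%:E
   _ _ _ _ _) _ => //.
- by rewrite lee_fin !(inv_gamma_cst_ge0, powR_ge0, expR_ge0, mulr_ge0).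
- by move=> t _; rewrite lee_fin inv_gamma_pdf_ge0.
- by move=> t _ /=; rewrite in_itv/= => ts; rewrite lee_fin inv_gamma_pdf_le.
- move=> t /=; rewrite !in_itv/= andbT => /negP; rewrite -leNgt => ts.
  by rewrite ts andbT /inv_gamma_pdf => /negP/negbTE ->.
by rewrite /= lebesgue_measure_itv/= lte_fin s0 oppr0 adde0.
Qed.

(** Only the unit interval []s, s + 1]] is kept. There the power factor is smallest at [s + 1] and
    the exponential factor at [s]. *)
Lemma inv_gamma_prob_ge (R : realType) (a b s : R) : 0 < a -> 0 < b -> 0 < s ->
  ((b `^ a / gamma_fun a * (s + 1) `^ (- (1 + a)) * expR (- (b / s)))%:E <=
   inv_gamma_prob a b `]s, +oo[)%E.
Proof.
move=> a0 b0 s0; rewrite /inv_gamma_prob.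
set c := (X in X%:E).
have -> : c%:E = (c%:E * lebesgue_measure `]s, (s + 1)%R])%E.
  rewrite lebesgue_measure_itv/= lte_fin ltrDl ltr01 -EFinD.
  by rewrite (_ : s + 1 - s = 1) ?mule1//; ring.
apply: cst_le_integral => //.
- by move=> t /=; rewrite !in_itv/= andbT => /andP[].
- by rewrite lee_fin !(inv_gamma_cst_ge0, powR_ge0, expR_ge0, mulr_ge0).
- by move=> t _; rewrite lee_fin inv_gamma_pdf_ge0.
move=> t /=; rewrite in_itv/= => /andP[st ts]; rewrite lee_fin /inv_gamma_pdf.
have t0 : 0 < t by exact: lt_trans st.
rewrite t0; apply: ler_pM; rewrite ?(inv_gamma_cst_ge0, powR_ge0, expR_ge0, mulr_ge0)//.
  apply: ler_wpM2l; first exact: inv_gamma_cst_ge0.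
  rewrite /powR !gt_eqF; [|lra..].
  rewrite ler_expR !mulNr lerN2 ler_wpM2l//; first lra.
  by rewrite ler_ln ?posrE//; lra.
rewrite ler_expR lerN2; apply: ler_wpM2l; first exact: ltW.
by rewrite lef_pV2 ?posrE// ltW.
Qed.

(** * Interpolation of exponential bounds and the final estimate *)

(* A weighted geometric mean of the two bounds on [p] removes the constant [expR L]. *)
Lemma exp_bound_interpolation (R : realType) (c Q L : R) : 0 < c -> 0 < Q -> 0 <= L ->
  exists2 C : R, 0 < C & forall p m : R,
    p <= expR (- Q) -> p <= expR (L - c * m) -> p <= expR (- (C * m)).
Proof.
move=> c0 Q0 L0; have QL : 0 < Q + L by lra.
(* The line [C m] through the origin passes through the point [m = (Q + L) / c] where [Q = c m - L],
   hence stays below the maximum of the two exponents. *)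
exists (c * Q / (Q + L)); first by rewrite divr_gt0 ?mulr_gt0.
move=> p m pQ pL; have [h|h] := leP (c * Q / (Q + L) * m) Q.
  by apply: le_trans pQ _; rewrite ler_expR lerN2.
apply: le_trans pL _; rewrite ler_expR.
have E : (c * Q / (Q + L) * m) * (Q + L) = c * m * Q by field; rewrite gt_eqF.
move: h E; set z := _ / _ * _ => h E; nra.
Qed.

Theorem theorem3p2 (R : realType) (alpha beta : R)
    (alpha_gt0 : 0 < alpha) (beta_gt0 : 0 < beta) :
  exists C : R, 0 < C /\
    forall (delta : R), 0 < delta < 1 ->
    forall (n : nat), (1 <= n)%N ->
    forall (d : measure_display) (Omega : measurableType d)
      (P : probability Omega R)
      (tau : {RV P >-> R}) (theta : 'I_n -> {RV P >-> R}),
    (forall A : set R, measurable A ->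
       distribution P tau A = inv_gamma_prob alpha beta A) ->
    cond_iid tau theta normal_var ->
    (P [set w | (l2norm (fun j => theta j w) < n%:R `^ (delta / 2))%R]
      <= (expR (- (C * n%:R `^ (1 - delta))))%:E)%E.
Proof.
set k := beta `^ alpha / gamma_fun alpha.
have [k0|kn0] := eqVneq k 0.
  (* [gamma_fun] is never shown to be positive and finite: a junk value 0 of the
     normalizing constant is excluded by the total mass of the law of [tau]. *)
  exists 1; split=> // delta _ n _ d Omega P tau theta tauE _; exfalso.
  have tau0 : distribution P tau setT = 0%E.
    rewrite tauE; last exact: measurableT.
    apply: integral0_eq => t _.
    by rewrite /inv_gamma_pdf -/k k0 !mul0r if_same.
  have tau1 : distribution P tau setT = 1%E by exact: probability_setT.
  by move: tau1; rewrite tau0 => /eqP; rewrite eq_sym onee_eq0.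
have k_gt0 : 0 < k by rewrite lt_def kn0 inv_gamma_cst_ge0.
(* The factor 256 comes from [l2norm_small_ball] and the factor 2 from the choice [a^2 = 2 / m]. As
   [m >= 1], [T] bounds every threshold [s = T / m], so [g] below bounds [P(tau > s)] from below
   uniformly. *)
have [T T0 TE] : exists2 T : R, 0 < T & T = 2 * 256.
  by exists (2 * 256); rewrite ?mulr_gt0 ?ltr0n.
pose g := k * (T + 1) `^ (- (1 + alpha)) * expR (- (beta / T)).
have g0 : 0 < g.
  apply: mulr_gt0; last exact: expR_gt0.
  by apply: mulr_gt0 => //; apply: powR_gt0; lra.
pose A0 := k * (2 * (1 + alpha) / beta) `^ (1 + alpha) * T.
have A0_ge0 : 0 <= A0.
  by apply: mulr_ge0; [apply: mulr_ge0; [exact: ltW|exact: powR_ge0]|exact: ltW].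
(* The first rate comes from [P(tau <= s)] at [s = T / m], the second from
   [2^(-n) <= exp(- n / 2) <= exp(- m / 2)]. *)
pose c := Num.min (beta / (2 * T)) 2^-1.
have c0 : 0 < c by rewrite lt_min divr_gt0 ?mulr_gt0//= invr_gt0.
have cb : c <= beta / (2 * T) by rewrite ge_min lexx.
have c2 : c <= 2^-1 by rewrite ge_min lexx orbT.
have L0 : 0 <= ln (A0 + 1) by apply: ln_ge0; lra.
have Q0 : 0 < g / 2 by rewrite divr_gt0.
have [C C0 CP] := exp_bound_interpolation _ _ _ _ c0 Q0 L0.
exists C; split=> // delta /andP[d0 d1] n n1 d Omega P tau theta tauE iid.
have n0 : (0 : R) < n%:R by rewrite ltr0n.
set m := n%:R `^ (1 - delta).
have m1 : 1 <= m.
  by rewrite -(powRr0 n%:R) ler_powR ?ler1n//; lra.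
have mn : m <= n%:R.
  by rewrite -[leRHS]powRr1 ?ler0n// ler_powR ?ler1n//; lra.
have m0 : 0 < m by lra.
pose s := T / m.
have s0 : 0 < s by rewrite divr_gt0.
have sT : s <= T by rewrite ler_pdivrMr// ler_peMr// ltW.
pose A : set R := `]s, +oo[%classic.
have mA : measurable A by exact: measurable_itv.
have a2 : Num.sqrt (2 / m) ^+ 2 = 2 / m by rewrite sqr_sqrtr// ltW// divr_gt0.
set r := n%:R `^ (delta / 2).
have rm : r ^+ 2 * m = n%:R.
  rewrite -powR_mulrn ?powR_ge0// -powRrM -powRD; last first.
    by apply/implyP => _; rewrite gt_eqF.
  by rewrite (_ : delta / 2 * 2 + (1 - delta) = 1) ?powRr1 ?ler0n//; field.
apply: (@le_trans _ _ (distribution P tau (~` A) +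
    (2^-1 ^+ n)%:E * distribution P tau A)%E).
  apply: (l2norm_small_ball _ _ _ _ _ _ _ _ (Num.sqrt (2 / m))) => //.
  - by move=> t; rewrite a2 /A/= in_itv/= andbT => /ltW; apply: le_trans; rewrite /s TE; lra.
  - exact: powR_ge0.
  - by rewrite sqrtr_gt0 divr_gt0.
  - rewrite a2 -rm.
    have -> : r ^+ 2 * m * (2 / m) = 2 * r ^+ 2 by field; rewrite gt_eqF.
    exact: lexx.
have [x xE] : exists x, distribution P tau A = x%:E.
  exists (fine (distribution P tau A)); rewrite fineK//.
  exact: fin_num_measure.
have cE : distribution P tau (~` A) = (1 - x)%:E.
  have -> : distribution P tau (~` A) = (1 - distribution P tau A)%E.
    exact: probability_setC.
  by rewrite xE.
have xC : 1 - x <= A0 * expR (- (beta * m / (2 * T))).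
  rewrite -lee_fin -cE tauE; last exact: measurableC.
  apply: le_trans (inv_gamma_prob_le _ _ _ _ _ _ s0) _ => //.
  rewrite lee_fin -/k (_ : beta / (2 * s) = beta * m / (2 * T)); last first.
    by rewrite /s; field; rewrite !gt_eqF.
  rewrite mulrAC; apply: ler_wpM2r; first exact: expR_ge0.
  by apply: ler_wpM2l => //; rewrite mulr_ge0 ?powR_ge0// ltW.
have gx : g <= x.
  rewrite -lee_fin -xE; apply: (@le_trans _ _ (distribution P tau `]T, +oo[)).
    rewrite tauE; last exact: measurable_itv.
    exact: inv_gamma_prob_ge.
  apply: le_measure; rewrite ?inE//.
  by move=> t; rewrite /A/= !in_itv/= !andbT; exact: le_lt_trans.
have x1 : x <= 1 by rewrite -lee_fin -xE; apply: probability_le1.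
rewrite cE xE -EFinM -EFinD lee_fin.
have half_n : 2^-1 ^+ n <= 2^-1 :> R by rewrite -[leRHS]expr1 ler_wiXn2l//; lra.
apply: CP.
  (* As [n >= 1], the sum is at most [1 - x / 2 <= 1 - g / 2]. *)
  apply: (@le_trans _ _ (1 + - (g / 2))); last exact: expR_ge1Dx.
  have : 2^-1 ^+ n * x <= 2^-1 * x by apply: ler_wpM2r => //; lra.
  lra.
(* Here [expR L = A0 + 1]: the summand [A0] pays for [P(tau <= s)] and the summand 1 for
   [2^(-n)]. *)
rewrite expRD lnK ?posrE; last lra.
rewrite mulrDl mul1r; apply: lerD.
  apply: le_trans xC _; apply: ler_wpM2l => //; rewrite ler_expR lerN2.
  by rewrite mulrAC ler_wpM2r// ltW.
apply: (@le_trans _ _ (2^-1 ^+ n)).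
  by rewrite ler_piMr// exprn_ge0.
have e2 : 2^-1 <= expR (- 2^-1) :> R by have := expR_ge1Dx (- 2^-1 : R); lra.
apply: (@le_trans _ _ (expR (- 2^-1) ^+ n)).
  by rewrite lerXn2r ?nnegrE ?expR_ge0.
rewrite -expRM_natl ler_expR; nra.
Qed.
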